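(* Let $l\geq 0$ and $d\geq 1$ be integers and let $\boldsymbol{\varepsilon}=(\varepsilon_n)_{n\geq 0}$ be a sequence of non-constant polynomials in $\mathbb{F}_2[t]$ which is ultimately periodic of type $(l,d)$, i.e. $\varepsilon_{n+d}=\varepsilon_n$ for all $n\geq l$. Let $\mathbf{s}(\boldsymbol{\varepsilon})=(s_i)_{i\geq 0}$ be the associated sequence and $\alpha=[s_0,s_1,s_2,\dots]\in\mathbb{F}_2((1/t))$ the associated continued fraction (see context). Then there is a polynomial $P\in \mathbb{F}_2(\boldsymbol{\varepsilon})[x]$ with $\deg_x P=2^d$ and $P(\alpha)=0$. More precisely, setting $\beta=1/\alpha$, there exist $d+1$ elements $A$ and $B_k$ ($0\leq k\leq d-1$) of $\mathbb{F}_2(\boldsymbol{\varepsilon})$ such that $$\beta^{2^d}=A+\sum_{k=0}^{d-1}B_k\,\beta^{2^k}.$$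
   Context: Given a sequence $\boldsymbol{\varepsilon}=(\varepsilon_n)_{n\geq 0}$, define words $W_0=$ empty word and $W_{n+1}=W_n\,\varepsilon_n\,W_n$ (concatenation) for $n\geq 0$; $W_{n+1}$ begins with $W_n$, and $\mathbf{s}(\boldsymbol{\varepsilon})$ is the infinite word beginning with every $W_n$, i.e. $\mathbf{s}(\boldsymbol{\varepsilon})=\varepsilon_0\varepsilon_1\varepsilon_0\varepsilon_2\varepsilon_0\varepsilon_1\varepsilon_0\varepsilon_3\cdots$. When the $\varepsilon_n$ are non-constant polynomials in $\mathbb{F}_2[t]$, $\alpha=CF(\mathbf{s}(\boldsymbol{\varepsilon}))=[s_0,s_1,\dots]=s_0+1/(s_1+1/(s_2+\cdots))$ is the infinite continued fraction in the field $\mathbb{F}_2((1/t))$ of formal Laurent series in $1/t$ with partial quotients $s_i$. For $\boldsymbol{\varepsilon}$ of type $(l,d)$, $\mathbb{F}_2(\boldsymbol{\varepsilon})$ denotes the subfield of $\mathbb{F}_2(t)$ generated by $\varepsilon_0,\dots,\varepsilon_{l+d-1}$. *)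

(* Defs.v *)
From HB Require Import structures.
From mathcomp Require Import all_boot all_order all_algebra fraction generic_quotient.
Set Implicit Arguments. Unset Strict Implicit. Unset Printing Implicit Defensive.
Import Order.TTheory GRing.Theory Num.Theory.
Local Open Scope ring_scope.

Notation F2 := 'F_2.
Notation "x %:F" := (@FracField.tofrac _ x).
Notation F2t := {fraction {poly 'F_2}}.

Fixpoint Wword (eps : nat -> {poly F2}) (n : nat) : seq {poly F2} :=
  match n with
  | 0 => [::]
  | n'.+1 => Wword eps n' ++ eps n' :: Wword eps n'
  end.

(* s_i is the i-th letter of W_{i+1} (of length 2^(i+1)-1 > i); since each
   W_n is a prefix of W_{n+1}, this is the infinite word beginning with every W_n *)
Definition sseq (eps : nat -> {poly F2}) (i : nat) : {poly F2} :=
  nth 0 (Wword eps i.+1) i.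

(* mkLS m g represents  sum_{n >= 0} g n * u^(n - m),  u = 1/t. *)
Record LS := mkLS { lsh : nat; lps : nat -> F2 }.

(* coefficient of u^k = t^(-k) *)
Definition lcoef (f : LS) (k : int) : F2 :=
  match (k + (lsh f)%:Z)%R with Posz n => lps f n | Negz _ => 0 end.

Definition lseq (f g : LS) : Prop := forall k, lcoef f k = lcoef g k.

Definition lszero : LS := mkLS 0 (fun _ => 0).
Definition lsone : LS := mkLS 0 (fun n => if n == 0%N then 1 else 0).

Definition lsadd (f g : LS) : LS :=
  let M := (lsh f + lsh g)%N in
  mkLS M (fun n => lcoef f (n%:Z - M%:Z) + lcoef g (n%:Z - M%:Z)).

Definition lsmul (f g : LS) : LS :=
  mkLS (lsh f + lsh g) (fun n => \sum_(i < n.+1) lps f i * lps g (n - i)%N).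

Definition lsexp (f : LS) (n : nat) : LS := iter n (lsmul f) lsone.

(* the polynomial p(t) = sum p_i t^i = sum p_i u^(-i) *)
Definition lspoly (p : {poly F2}) : LS :=
  mkLS (size p) (fun n => if (n <= size p)%N then p`_(size p - n) else 0).

(* inverse power series of h(u) with h 0 <> 0: coefficients g_0..g_n *)
Fixpoint invlist (h : nat -> F2) (n : nat) : seq F2 :=
  match n with
  | 0 => [:: (h 0%N)^-1]
  | n'.+1 => let s := invlist h n' in
      rcons s (- (h 0%N)^-1 * \sum_(i < n'.+1) h i.+1 * nth 0 s (n' - i)%N)
  end.

(* 1/p for p <> 0 : p = t^e h(u), h(u) = sum_{i<=e} p_(e-i) u^i, so 1/p = u^e / h(u) *)
Definition lsinvpoly (p : {poly F2}) : LS :=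
  let e := (size p).-1 in
  let h := fun i => if (i <= e)%N then p`_(e - i) else 0 in
  mkLS 0 (fun n => if (e <= n)%N then nth 0 (invlist h (n - e)) (n - e) else 0).

Definition lsembed (r : F2t) : LS :=
  let x := repr r in lsmul (lspoly \n_x) (lsinvpoly \d_x).

Definition lspeval (P : {poly F2t}) (a : LS) : LS :=
  \big[lsadd/lszero]_(i < size P) lsmul (lsembed P`_i) (lsexp a i).

Fixpoint cfr (l : seq {poly F2}) : F2t :=
  match l with
  | [::] => 0
  | [:: a] => a%:F
  | a :: l' => a%:F + (cfr l')^-1
  end.

Definition convergent (s : nat -> {poly F2}) (n : nat) : F2t := cfr (mkseq s n.+1).

Definition is_CF (s : nat -> {poly F2}) (alpha : LS) : Prop :=
  forall N : int, exists n0 : nat, forall n : nat, (n0 <= n)%N ->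
    forall k : int, k < N -> lcoef alpha k = lcoef (lsembed (convergent s n)) k.

Inductive in_Feps (eps : nat -> {poly F2}) (m : nat) : F2t -> Prop :=
| Fe_gen i : (i < m)%N -> in_Feps eps m (eps i)%:F
| Fe_one : in_Feps eps m 1
| Fe_add x y : in_Feps eps m x -> in_Feps eps m y -> in_Feps eps m (x + y)
| Fe_opp x : in_Feps eps m x -> in_Feps eps m (- x)
| Fe_mul x y : in_Feps eps m x -> in_Feps eps m y -> in_Feps eps m (x * y)
| Fe_inv x : in_Feps eps m x -> in_Feps eps m x^-1.

(* Main.v *)
(* The words W_n are palindromes, and in characteristic 2 the convergent [W_n] is
   p_n / q_n with p_(n+1) = eps_n p_n^2 and q_(n+1) = eps_n p_n q_n + 1.  Hence
   q_(n+1) / p_(n+1) = q_n / p_n + 1 / p_(n+1), and beta is the limit of these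
   fractions, i.e. the sum of the 1 / p_n for n >= 1.  By Frobenius, beta^(2^k) is
   the sum of the c_k(n+k) / p_(n+k), where the ratios c_k(m) = p_m / p_(m-k)^(2^k)
   are products of powers of the eps_i and are d-periodic in m from some rank on.
   So c_0, ..., c_d are d+1 sequences in an essentially d-dimensional space, hence
   linearly dependent; since c_(k+1)(m) = eps_(m-1) c_k(m-1)^2, squaring turns a
   relation with top term c_J into one with top term c_(J+1), so that c_d is a
   combination of c_0, ..., c_(d-1).  The same combination of the beta^(2^k) then
   telescopes to an element of F_2(eps). *)
Require Import Defs.
From HB Require Import structures.
From mathcomp Require Import all_boot all_order all_algebra fraction generic_quotient.
From mathcomp Require Import boolp ring zify.
Set Implicit Arguments. Unset Strict Implicit. Unset Printing Implicit Defensive.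
Import Order.TTheory GRing.Theory Num.Theory.
Local Open Scope ring_scope.

(** * Formal power series *)

Record pseries (R : Type) := PSeries { psc : nat -> R }.

HB.instance Definition _ (R : Type) := gen_eqMixin (pseries R).
HB.instance Definition _ (R : Type) := gen_choiceMixin (pseries R).

Lemma pseriesP (R : Type) (f g : pseries R) : (forall n, psc f n = psc g n) <-> f = g.
Proof.
split=> [|-> //]; case: f g => [f] [g] /= fg.
by congr PSeries; apply/funext.
Qed.

Section PowerSeriesZmodule.
Variable R : zmodType.
Implicit Types f g h : pseries R.

Definition ps0 : pseries R := PSeries (fun _ => 0).
Definition psopp f : pseries R := PSeries (fun n => - psc f n).
Definition psadd f g : pseries R := PSeries (fun n => psc f n + psc g n).

Lemma psaddA : associative psadd.
Proof. by move=> f g h; apply/pseriesP => n /=; rewrite addrA. Qed.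
Lemma psaddC : commutative psadd.
Proof. by move=> f g; apply/pseriesP => n /=; rewrite addrC. Qed.
Lemma psadd0 : left_id ps0 psadd.
Proof. by move=> f; apply/pseriesP => n /=; rewrite add0r. Qed.
Lemma psaddN : left_inverse ps0 psopp psadd.
Proof. by move=> f; apply/pseriesP => n /=; rewrite addNr. Qed.

HB.instance Definition _ := GRing.isZmodule.Build (pseries R) psaddA psaddC psadd0 psaddN.

Lemma pscD f g n : psc (f + g) n = psc f n + psc g n. Proof. by []. Qed.
Lemma pscB f g n : psc (f - g) n = psc f n - psc g n. Proof. by []. Qed.

End PowerSeriesZmodule.

Section PowerSeriesRing.
Variable R : comNzRingType.
Implicit Types f g h : pseries R.

Definition ps1 : pseries R := PSeries (fun n => (n == 0%N)%:R).
Definition psmul f g : pseries R :=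
  PSeries (fun n => \sum_(i < n.+1) psc f i * psc g (n - i)%N).

Definition pstrunc n f : {poly R} := \poly_(i < n) psc f i.

(** A coefficient of a product depends on finitely many coefficients of the factors, so the ring
    axioms can be inherited from [{poly R}] by truncation. *)
Lemma pscM_poly n f g (p q : {poly R}) :
    (forall i, (i < n)%N -> psc f i = p`_i) ->
    (forall i, (i < n)%N -> psc g i = q`_i) ->
  forall i, (i < n)%N -> psc (psmul f g) i = (p * q)`_i.
Proof.
move=> fp gq i lt_in; rewrite /= coefM; apply: eq_bigr => j _.
rewrite fp ?gq //; first by apply: leq_ltn_trans lt_in; apply: leq_subr.
by apply: leq_ltn_trans lt_in; rewrite -ltnS.
Qed.

Lemma coef_pstrunc n f i : (i < n)%N -> psc f i = (pstrunc n f)`_i.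
Proof. by move=> lt_in; rewrite coef_poly lt_in. Qed.

Lemma psmulA : associative psmul.
Proof.
move=> f g h; apply/pseriesP => n.
have tr f := @coef_pstrunc n.+1 f.
rewrite (pscM_poly (tr f) (pscM_poly (tr g) (tr h))) //.
by rewrite (pscM_poly (pscM_poly (tr f) (tr g)) (tr h)) // mulrA.
Qed.

Lemma psmulC : commutative psmul.
Proof.
move=> f g; apply/pseriesP => n; have tr f := @coef_pstrunc n.+1 f.
by rewrite (pscM_poly (tr f) (tr g)) // (pscM_poly (tr g) (tr f)) // mulrC.
Qed.

Lemma psmul1 : left_id ps1 psmul.
Proof.
move=> f; apply/pseriesP => n /=.
by rewrite big_ord_recl subn0 mul1r big1 ?addr0 // => i _; rewrite mul0r.
Qed.

Lemma psmulDl : left_distributive psmul +%R.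
Proof.
move=> f g h; apply/pseriesP => n /=.
by rewrite -big_split; apply: eq_bigr => i _; rewrite mulrDl.
Qed.

Lemma ps1_neq0 : ps1 != 0.
Proof. by apply/eqP => /pseriesP /(_ 0%N) /eqP; rewrite oner_eq0. Qed.

HB.instance Definition _ :=
  GRing.Zmodule_isComNzRing.Build (pseries R) psmulA psmulC psmul1 psmulDl ps1_neq0.

Lemma pscM f g n : psc (f * g) n = \sum_(i < n.+1) psc f i * psc g (n - i)%N.
Proof. by []. Qed.

Lemma psc1 n : psc (1 : pseries R) n = (n == 0%N)%:R. Proof. by []. Qed.

Definition psC (a : R) : pseries R := PSeries (fun n => if n == 0%N then a else 0).
Definition psX : pseries R := PSeries (fun n => (n == 1%N)%:R).

Lemma pscXM f n : psc (psX * f) n = if n is n'.+1 then psc f n' else 0.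
Proof.
case: n => [|n]; first by rewrite pscM big_ord1 mul0r.
rewrite pscM 2!big_ord_recl [psc psX _]/= mul0r add0r mul1r subSS subn0.
by rewrite big1 ?addr0 // => i _; rewrite mul0r.
Qed.

Lemma pscXnM m f n :
  psc (psX ^+ m * f) n = if (n < m)%N then 0 else psc f (n - m).
Proof.
elim: m n => [|m IHm] n; first by rewrite expr0 mul1r subn0.
by rewrite exprS -mulrA pscXM; case: n => [|n] //; rewrite IHm.
Qed.

Lemma psXn_dvd n f : (forall i, (i < n)%N -> psc f i = 0) -> exists g, f = psX ^+ n * g.
Proof.
move=> f0; exists (PSeries (fun i => psc f (n + i))); apply/pseriesP => i.
by rewrite pscXnM; case: ltnP => [/f0|ni] //=; rewrite subnKC.
Qed.

Lemma psC_is_zmod_morphism : zmod_morphism psC.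
Proof. by move=> a b; apply/pseriesP => -[|n]; rewrite pscB /= ?subr0. Qed.

Lemma psC_is_monoid_morphism : monoid_morphism psC.
Proof.
split; first by apply/pseriesP => -[|n].
move=> a b; apply/pseriesP => n; rewrite pscM big_ord_recl /= subn0.
rewrite big1 ?addr0 => [|i _]; last exact: mul0r.
by case: n => [|n] //=; rewrite mulr0.
Qed.

HB.instance Definition _ := GRing.isZmodMorphism.Build R (pseries R) psC psC_is_zmod_morphism.
HB.instance Definition _ := GRing.isMonoidMorphism.Build R (pseries R) psC psC_is_monoid_morphism.

Lemma pscCM a f n : psc (psC a * f) n = a * psc f n.
Proof.
by rewrite pscM big_ord_recl /= subn0 big1 ?addr0 // => i _; rewrite mul0r.
Qed.

Lemma psc_sum (I : Type) (r : seq I) (P : pred I) (F : I -> pseries R) n :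
  psc (\sum_(i <- r | P i) F i) n = \sum_(i <- r | P i) psc (F i) n.
Proof. by elim/big_rec2: _ => // i x y _ <-. Qed.

(** Inverses are picked by classical choice; the unit ring structure is what [idomainType], and
    hence [{fraction _}], requires. *)
Definition psunit : pred (pseries R) := fun f => `[< exists g, g * f = 1 >].
Definition psinv f : pseries R :=
  if pselect (exists g, g * f = 1) is left fV then projT1 (cid fV) else f.

Lemma psmulV : {in psunit, left_inverse 1 psinv *%R}.
Proof. by move=> f /asboolP fV; rewrite /psinv; case: pselect => // {}fV; case: cid. Qed.

Lemma psunitPl f g : g * f = 1 -> psunit f.
Proof. by move=> gf; apply/asboolP; exists g. Qed.

Lemma psinv_out : {in [predC psunit], psinv =1 id}.
Proof. by move=> f /asboolP fV; rewrite /psinv; case: pselect. Qed.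

HB.instance Definition _ :=
  GRing.ComNzRing_hasMulInverse.Build (pseries R) psmulV psunitPl psinv_out.

End PowerSeriesRing.

Section PowerSeriesDomain.
Variable R : idomainType.

Lemma ps_order (f : pseries R) : f != 0 -> exists n g, f = psX R ^+ n * g /\ psc g 0 != 0.
Proof.
move=> f_neq0.
have exf : exists n, psc f n != 0.
  apply: contrapT => f0; move/eqP: f_neq0; apply; apply/pseriesP => n.
  by apply: contrapT => /eqP fn; apply: f0; exists n.
case: (ex_minnP exf) => n fn minf; exists n.
have [i lt_in|g fE] := @psXn_dvd _ n f.
  by apply/eqP; apply: contraLR lt_in => /minf; rewrite -leqNgt.
by exists g; split=> //; move: fn; rewrite fE pscXnM ltnn subnn.
Qed.

Lemma ps_integral : GRing.integral_domain_axiom (pseries R).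
Proof.
move=> f g fg0; apply/norP => -[/ps_order [m [f' [fE f'0]]] /ps_order [n [g' [gE g'0]]]].
move/pseriesP/(_ (m + n)%N): fg0; rewrite fE gE mulrACA -exprD pscXnM ltnn subnn.
by rewrite pscM big_ord1 => /eqP; rewrite mulf_eq0 (negbTE f'0) (negbTE g'0).
Qed.

HB.instance Definition _ := GRing.ComUnitRing_isIntegral.Build (pseries R) ps_integral.

Lemma psX_neq0 : psX R != 0.
Proof. by apply/eqP => /pseriesP /(_ 1%N) /eqP; rewrite oner_eq0. Qed.

End PowerSeriesDomain.

(** * The field of Laurent series *)

(* With u = 1/t and e = size p - 1, one has p(t) = u^(-e) * revps p. *)
Definition revps (R : comNzRingType) (p : {poly R}) : pseries R :=
  PSeries (fun i => if (i <= (size p).-1)%N then p`_((size p).-1 - i) else 0).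

(** Both sides are u^(size p) p(1/u); the extra factor u matches the shift [size p] of [lspoly] and
    makes p = 0 uniform. *)
Lemma revps_sum (R : comNzRingType) (p : {poly R}) :
  psX R * revps p = \sum_(i < size p) psC p`_i * psX R ^+ (size p - i).
Proof.
apply/pseriesP => n; rewrite pscXM psc_sum.
under eq_bigr => i _.
  rewrite pscCM -[psX R ^+ _]mulr1 pscXnM psc1.
  over.
case: n => [|n].
  by rewrite big1 // => i _; rewrite subn_gt0 ltn_ord mulr0.
rewrite /=; case: leqP => np; last first.
  have pn : (size p <= n)%N by case: (size p) np.
  rewrite big1 // => i _; have lt_n : (size p - i < n.+1)%N.
    by rewrite ltnS (leq_trans (leq_subr _ _) pn).
  by rewrite ltnNge ltnW //= subn_eq0 leqNgt lt_n mulr0.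
have [p0|p_gt0] := posnP (size p).
  have ->: p = 0 by apply/eqP; rewrite -size_poly_eq0 p0.
  rewrite coef0 size_poly0 big_ord0 //.
have lt_i : ((size p).-1 - n < size p)%N by lia.
rewrite (bigD1 (Ordinal lt_i)) //= big1 ?addr0 => [|i /eqP neq_i].
  have -> : (size p - ((size p).-1 - n) = n.+1)%N by move: (size p) p_gt0 np => s; lia.
  by rewrite ltnn subnn mulr1.
case: ltnP => le_n; rewrite ?mulr0 // subn_eq0; case: leqP => ge_n; rewrite ?mulr0 //.
case: neq_i; apply: val_inj => /=; move: (size p) (nat_of_ord i) (ltn_ord i) le_n ge_n.
by lia.
Qed.

Notation laurent := {fraction (pseries F2)}.
(* The variable u = 1/t. *)
Definition lu : laurent := (psX F2)%:F.

Lemma lu_neq0 : lu != 0. Proof. by rewrite tofrac_eq0 psX_neq0. Qed.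

Lemma lu_unit : lu \is a GRing.unit. Proof. by rewrite unitfE lu_neq0. Qed.

(** * Interpretation of the records [LS] in the field of Laurent series *)

Definition lspser (f : LS) : pseries F2 := PSeries (lps f).
Definition laurent_of (f : LS) : laurent := (lspser f)%:F / lu ^+ lsh f.

(** Multiplying by u^M brings records with different shifts to a common one. *)
Lemma lcoef_psXnM f M n :
  lcoef f (n%:Z - (lsh f + M)%N%:Z) = psc (psX F2 ^+ M * lspser f) n.
Proof.
rewrite pscXnM /lcoef; case: ltnP => nM.
  by have ->: n%:Z - (lsh f + M)%N%:Z + (lsh f)%:Z = Negz (M - n).-1 by lia.
by have ->: n%:Z - (lsh f + M)%N%:Z + (lsh f)%:Z = Posz (n - M)%N by lia.
Qed.

Lemma laurent_ofE f M : (psX F2 ^+ M * lspser f)%:F = laurent_of f * lu ^+ (lsh f + M).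
Proof.
rewrite rmorphM rmorphXn /= exprD mulrA divfK ?expf_neq0 ?lu_neq0 //.
by rewrite mulrC.
Qed.

(** After multiplication by u^(lsh f + lsh g) both series are power series and can be compared
    coefficientwise. From here on [lseq] is an equality in a field. *)
Lemma lseqP f g : lseq f g <-> laurent_of f = laurent_of g.
Proof.
have FE := laurent_ofE f (lsh g); have GE := laurent_ofE g (lsh f).
have uN0 n : lu ^+ n != 0 by rewrite expf_neq0 ?lu_neq0.
split=> [fg|fg k].
  apply: (mulIf (uN0 (lsh f + lsh g)%N)); rewrite -FE addnC -GE.
  congr (_%:F); apply/pseriesP => n.
  by rewrite -!lcoef_psXnM [in RHS]addnC fg.
have fgP : psX F2 ^+ lsh g * lspser f = psX F2 ^+ lsh f * lspser g.
  by apply/eqP; rewrite -tofrac_eq FE GE fg addnC.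
case kE: (k + (lsh f + lsh g)%N%:Z) => [n|n].
  have ->: k = n%:Z - (lsh f + lsh g)%N%:Z by rewrite -kE addrK.
  by rewrite lcoef_psXnM fgP addnC lcoef_psXnM.
(* For exponents below both pole orders [lcoef] takes its default value 0. *)
rewrite /lcoef.
have ->: k + (lsh f)%:Z = Negz (n + lsh g) by lia.
by have ->: k + (lsh g)%:Z = Negz (n + lsh f) by lia.
Qed.

Lemma laurent_of0 : laurent_of lszero = 0.
Proof. by rewrite /laurent_of (_ : lspser _ = 0) ?rmorph0 ?mul0r //; apply/pseriesP. Qed.

Lemma laurent_of1 : laurent_of lsone = 1.
Proof.
rewrite /laurent_of (_ : lspser _ = 1) ?rmorph1 ?mul1r ?invr1 //.
by apply/pseriesP => -[|n].
Qed.

Lemma laurent_ofD f g : laurent_of (lsadd f g) = laurent_of f + laurent_of g.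
Proof.
rewrite {1}/laurent_of /=.
have ->: lspser (lsadd f g) = psX F2 ^+ lsh g * lspser f + psX F2 ^+ lsh f * lspser g.
  by apply/pseriesP => n; rewrite pscD -!lcoef_psXnM [(lsh g + _)%N]addnC.
rewrite rmorphD /= !laurent_ofE [(lsh g + _)%N]addnC -mulrDl mulfK //.
by rewrite expf_neq0 ?lu_neq0.
Qed.

Lemma laurent_ofM f g : laurent_of (lsmul f g) = laurent_of f * laurent_of g.
Proof.
rewrite {1}/laurent_of /= (_ : lspser (lsmul f g) = lspser f * lspser g); last exact/pseriesP.
by rewrite rmorphM exprD invfM mulrACA.
Qed.

Lemma laurent_ofX f n : laurent_of (lsexp f n) = laurent_of f ^+ n.
Proof.
elim: n => [|n IHn]; first by rewrite expr0 laurent_of1.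
by rewrite exprS -IHn -laurent_ofM.
Qed.

Lemma laurent_of_sum n (F : 'I_n -> LS) :
  laurent_of (\big[lsadd/lszero]_(i < n) F i) = \sum_(i < n) laurent_of (F i).
Proof. exact: (big_morph _ laurent_ofD laurent_of0). Qed.

(** * Embeddings of F_2[t] and F_2(t) *)

Definition lconst : F2 -> laurent := @FracField.tofrac _ \o @psC F2.
HB.instance Definition _ := GRing.RMorphism.on lconst.

(** Evaluation at t = 1/u, written as a composite so that it inherits its morphism structure. *)
Definition poly_laurent : {poly F2} -> laurent := horner_eval lu^-1 \o map_poly lconst.
HB.instance Definition _ := GRing.RMorphism.on poly_laurent.

Lemma poly_laurentE (p : {poly F2}) :
  poly_laurent p = (psX F2 * revps p)%:F / lu ^+ size p.
Proof.
rewrite revps_sum /poly_laurent /= /horner_eval (@horner_coef_wide _ (size p)) ?size_poly //.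
rewrite rmorph_sum mulr_suml; apply: eq_bigr => i _ /=.
rewrite coef_map rmorphM rmorphXn -mulrA; congr (_ * _).
by rewrite exprB ?lu_unit ?(ltnW (ltn_ord i)) // mulrAC mulfV ?expf_neq0 ?lu_neq0 // mul1r exprVn.
Qed.

Lemma laurent_of_poly p : laurent_of (lspoly p) = poly_laurent p.
Proof.
rewrite poly_laurentE /laurent_of /=; congr (_%:F / _).
(* The shift of [lspoly] exceeds the degree by one, so its entry 0 vanishes. *)
apply/pseriesP => -[|n]; rewrite pscXM /=; first by rewrite subn0 nth_default.
have [->|] := eqVneq p 0; first by rewrite !coef0 !if_same.
by rewrite -size_poly_gt0; case: (size p).
Qed.

Lemma size_invlist h n : size (invlist h n) = n.+1.
Proof. by elim: n => //= n IHn; rewrite size_rcons IHn. Qed.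

Lemma nth_invlist h n i : (i <= n)%N -> nth 0 (invlist h n) i = nth 0 (invlist h i) i.
Proof.
elim: n => [|n IHn]; first by case: i.
rewrite leq_eqVlt => /predU1P[-> //|]; rewrite ltnS => le_in.
by rewrite nth_rcons size_invlist ltnS le_in IHn.
Qed.

Lemma invlistS h n : nth 0 (invlist h n.+1) n.+1 =
  - (h 0%N)^-1 * \sum_(i < n.+1) h i.+1 * nth 0 (invlist h (n - i)) (n - i)%N.
Proof.
rewrite /= nth_rcons size_invlist ltnn eqxx; congr (_ * _).
by apply: eq_bigr => i _; rewrite nth_invlist ?leq_subr.
Qed.

(** The recursion of [invlist] solves the coefficient of index n+1 in f * g = 1 for g_(n+1). *)
Lemma invlistP (f : pseries F2) : psc f 0 != 0 ->
  f * PSeries (fun n => nth 0 (invlist (psc f) n) n) = 1.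
Proof.
move=> f0; apply/pseriesP => -[|n]; rewrite pscM psc1.
  by rewrite big_ord1 /= divff.
set g := PSeries _; have gS := invlistS (psc f) n : psc g n.+1 = _.
rewrite big_ord_recl [(n.+1 - _)%N]subn0 gS mulNr mulrN mulVKf //.
by apply/eqP; rewrite addrC subr_eq0; apply/eqP/eq_bigr => i _ /=; rewrite subSS.
Qed.

Lemma poly_laurent_eq0 p : (poly_laurent p == 0) = (p == 0).
Proof.
have [->|p_neq0] := eqVneq p 0; first by rewrite rmorph0 eqxx.
rewrite poly_laurentE mulf_eq0 invr_eq0 expf_eq0 (negbTE lu_neq0) andbF orbF.
rewrite tofrac_eq0 mulf_eq0 (negbTE (psX_neq0 _)) /=.
apply/negP => /eqP /pseriesP /(_ 0%N) /= /eqP.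
by rewrite subn0 -lead_coefE lead_coef_eq0 (negbTE p_neq0).
Qed.

Lemma laurent_of_invpoly p : p != 0 -> laurent_of (lsinvpoly p) = (poly_laurent p)^-1.
Proof.
move=> p_neq0; have s_gt0 : (0 < size p)%N by rewrite size_poly_gt0.
have p0 : psc (revps p) 0 != 0 by rewrite /= subn0 -lead_coefE lead_coef_eq0.
have fV := invlistP p0; set g := PSeries _ in fV.
have gE : lspser (lsinvpoly p) = psX F2 ^+ (size p).-1 * g.
  by apply/pseriesP => n; rewrite pscXnM /=; case: leqP.
apply: (mulIf (_ : poly_laurent p != 0)); rewrite ?mulVf ?poly_laurent_eq0 //.
rewrite /laurent_of gE poly_laurentE /= expr0 divr1 mulrA -rmorphM.
have -> : psX F2 ^+ (size p).-1 * g * (psX F2 * revps p) = psX F2 ^+ (size p).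
  by rewrite mulrACA -exprSr prednK // [g * _]mulrC fV mulr1.
by rewrite rmorphXn mulfV // expf_neq0 ?lu_neq0.
Qed.


(** [lsembed] reads numerator and denominator off [repr]; this ties them back to the fraction. *)
Lemma fraction_reprE (R : idomainType) (x : {fraction R}) :
  x = (\n_(repr x))%:F / (\d_(repr x))%:F.
Proof.
rewrite -[LHS]reprK; move: (repr x) => y.
have d_neq0 : \d_y != 0 by apply: denom_ratioP.
apply: (mulIf (_ : (\d_y)%:F != 0)); rewrite ?divfK ?tofrac_eq0 //.
unlock FracField.tofrac; rewrite -[LHS]FracField.pi_mul.
apply/eqmodP; rewrite /= FracField.equivfE /FracField.mulf.
by rewrite !numden_Ratio ?(oner_eq0, mulf_neq0) // !mulr1 mulrC.
Qed.

Definition frac_laurent (x : F2t) : laurent :=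
  poly_laurent \n_(repr x) / poly_laurent \d_(repr x).

Lemma laurent_of_embed x : laurent_of (lsembed x) = frac_laurent x.
Proof.
by rewrite laurent_ofM laurent_of_poly laurent_of_invpoly ?denom_ratioP.
Qed.

(** Cross-multiplication makes the value independent of the representative that [repr] selects. *)
Lemma frac_laurentE (a b : {poly F2}) : b != 0 ->
  frac_laurent (a%:F / b%:F) = poly_laurent a / poly_laurent b.
Proof.
move=> b_neq0; rewrite /frac_laurent; have := fraction_reprE (a%:F / b%:F).
move: (repr _) => y; have d_neq0 : \d_y != 0 by apply: denom_ratioP.
move/eqP; rewrite eqr_div ?tofrac_eq0 // -!rmorphM /= tofrac_eq => /eqP ab.
by apply/eqP; rewrite eqr_div ?poly_laurent_eq0 // -!rmorphM /= ab.
Qed.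

Lemma frac_laurent_poly a : frac_laurent a%:F = poly_laurent a.
Proof.
by rewrite -[a%:F]divr1 -tofrac1 frac_laurentE ?oner_eq0 // rmorph1 divr1.
Qed.

Lemma fraction_ind (R : idomainType) (P : {fraction R} -> Prop) :
  (forall a b : R, b != 0 -> P (a%:F / b%:F)) -> forall x, P x.
Proof. by move=> Pab x; rewrite [x]fraction_reprE; apply: Pab; apply: denom_ratioP. Qed.

Lemma frac_laurent_is_zmod_morphism : zmod_morphism frac_laurent.
Proof.
elim/fraction_ind=> a b b_neq0; elim/fraction_ind=> c d d_neq0.
rewrite -mulNr -rmorphN addf_div ?tofrac_eq0 // -!rmorphM -rmorphD /=.
rewrite !frac_laurentE ?mulf_neq0 // rmorphD !rmorphM rmorphN /= -mulNr.
by rewrite addf_div ?poly_laurent_eq0.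
Qed.

Lemma frac_laurent_is_monoid_morphism : monoid_morphism frac_laurent.
Proof.
split; first by rewrite -tofrac1 frac_laurent_poly rmorph1.
elim/fraction_ind=> a b b_neq0; elim/fraction_ind=> c d d_neq0.
rewrite mulf_div -!rmorphM /= !frac_laurentE ?mulf_neq0 //.
by rewrite !rmorphM /= mulf_div.
Qed.

HB.instance Definition _ :=
  GRing.isZmodMorphism.Build F2t laurent frac_laurent frac_laurent_is_zmod_morphism.
HB.instance Definition _ :=
  GRing.isMonoidMorphism.Build F2t laurent frac_laurent frac_laurent_is_monoid_morphism.

(** * The u-adic valuation *)

(* The u-adic valuation of z is at least N. *)
Definition ord_ge (N : int) (z : laurent) := exists g : pseries F2, z = g%:F * lu ^ N.

Lemma ord_ge_le N M z : M <= N -> ord_ge N z -> ord_ge M z.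
Proof.
move=> leMN [g ->]; exists (g * psX F2 ^+ `|N - M|%N).
rewrite rmorphM rmorphXn -mulrA; congr (_ * _).
by rewrite -/lu exprnP gez0_abs ?subr_ge0 // -expfzDr ?lu_neq0 // subrK.
Qed.

Lemma ord_ge0 N : ord_ge N 0.
Proof. by exists 0; rewrite rmorph0 mul0r. Qed.

Lemma ord_geD N y z : ord_ge N y -> ord_ge N z -> ord_ge N (y + z).
Proof. by move=> [g ->] [h ->]; exists (g + h); rewrite rmorphD mulrDl. Qed.

Lemma ord_geN N z : ord_ge N z -> ord_ge N (- z).
Proof. by move=> [g ->]; exists (- g); rewrite rmorphN mulNr. Qed.

Lemma ord_geM N M y z : ord_ge N y -> ord_ge M z -> ord_ge (N + M) (y * z).
Proof.
move=> [g ->] [h ->]; exists (g * h).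
by rewrite rmorphM expfzDr ?lu_neq0 // mulrACA.
Qed.

Lemma ord_geX (N : nat) z n : (0 < n)%N -> ord_ge N%:Z z -> ord_ge N%:Z (z ^+ n).
Proof.
move=> + zN; elim: n => [//|[|n] IHn] _; first by rewrite expr1.
rewrite exprS; apply: ord_ge_le (ord_geM zN (IHn isT)).
by rewrite lerDl.
Qed.

(** If f / g = h u^(n+1), then f = h g u^(n+1) has zero coefficient at n. *)
Lemma ord_ge_all0 z : (forall n : nat, ord_ge n%:Z z) -> z = 0.
Proof.
elim/fraction_ind: z => f g g_neq0 zN; suff -> : f = 0 by rewrite rmorph0 mul0r.
apply/pseriesP => n; have [h] := zN n.+1; move/(congr1 ( *%R^~ g%:F)).
rewrite divfK ?tofrac_eq0 // -exprnP -rmorphXn -!rmorphM /= => /eqP.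
rewrite tofrac_eq => /eqP ->.
by rewrite -mulrA mulrCA pscXnM ltnSn.
Qed.

Lemma ord_ge_laurent_of f : ord_ge (- (lsh f)%:Z) (laurent_of f).
Proof. by exists (lspser f); rewrite -invr_expz. Qed.

Lemma ord_ge_frac x : exists M : nat, ord_ge (- M%:Z) (frac_laurent x).
Proof. by rewrite -laurent_of_embed; eexists; apply: ord_ge_laurent_of. Qed.

Lemma ord_ge_polyV p : p != 0 -> ord_ge 0 (poly_laurent p)^-1.
Proof. by move=> p_neq0; rewrite -laurent_of_invpoly //; apply: ord_ge_laurent_of. Qed.

Lemma ord_ge_lcoef (N : nat) f g : (forall k, k < N%:Z -> lcoef f k = lcoef g k) ->
  ord_ge N%:Z (laurent_of f - laurent_of g).
Proof.
move=> fg; set M := (lsh f + lsh g)%N.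
have uM0 : lu ^+ M != 0 by rewrite expf_neq0 ?lu_neq0.
(* At the common shift M, agreement below N means that the first N + M coefficients of the
   difference vanish. *)
have [n|h hE] := @psXn_dvd _ (N + M) (psX F2 ^+ lsh g * lspser f - psX F2 ^+ lsh f * lspser g).
  move=> lt_n; rewrite pscB -!lcoef_psXnM [(lsh g + _)%N]addnC fg ?subrr //.
  rewrite -/M ltrBlDr -PoszD ltz_nat //.
exists h; apply: (mulIf uM0); rewrite mulrBl -{1}laurent_ofE /M addnC -laurent_ofE.
rewrite -rmorphB /= hE rmorphM rmorphXn /= -/lu exprD mulrC mulrA -exprnP.
by rewrite [(lsh g + _)%N]addnC.
Qed.

(** * Linear algebra over a subfield *)

(** Gaussian elimination on n+1 rows of length n; only field operations occur, so the coefficients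
    stay in S. *)
Lemma linear_relation (F : fieldType) (S : divringClosed F) n (v : nat -> nat -> F) :
    (forall i j, v i j \in S) ->
  exists a : nat -> F, [/\ forall i, a i \in S, exists2 i, (i <= n)%N & a i != 0 &
    forall j, (j < n)%N -> \sum_(i < n.+1) a i * v i j = 0].
Proof.
elim: n v => [|n IHn] v vS.
  by exists (fun _ => 1); split=> [i||//]; [exact: rpred1 | exists 0%N; rewrite ?oner_eq0].
have [[k vk]|v0] := pselect (exists k : 'I_n.+2, v k n != 0); last first.
  have [a [aS [i le_in ai] av]] := IHn v vS.
  (* Column n is zero: a relation between the first n+1 rows on the other columns suffices, the last
     row getting coefficient 0. *)
  exists (fun i => if (i <= n)%N then a i else 0); split=> [j||j].
  - by case: ifP; rewrite ?rpred0.
  - by exists i; [apply: leqW | rewrite le_in].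
  rewrite ltnS leq_eqVlt => /predU1P[->|/av avj].
    rewrite big1 // => m _; have [->|vm] := eqVneq (v m n) 0; first by rewrite mulr0.
    by case: v0; exists m.
  rewrite big_ord_recr /= ltnn mul0r addr0 -[RHS]avj; apply: eq_bigr => m _.
  by rewrite -ltnS ltn_ord.
(* Row k is the pivot; [bump k] enumerates the other rows, and w clears their column n. *)
pose w i j := v (bump k i) j - v (bump k i) n / v k n * v k j.
have [|a [aS [i le_in ai] aw]] := IHn w.
  by move=> i j; rewrite rpredB ?rpredM ?rpredV.
(* The coefficient of the pivot row collects the multiples subtracted in w. *)
pose ak := - \sum_(i < n.+1) a i * (v (bump k i) n / v k n).
exists (fun i => if i == k :> nat then ak else a (unbump k i)); split=> [j||j lt_j].
- by case: ifP => _ //; rewrite rpredN rpred_sum // => m _; rewrite ?rpredM ?rpredV.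
- exists (bump k i); last by rewrite /= [bump _ _ == _]eq_sym (negbTE (neq_bump _ _)) bumpK.
  by rewrite /bump; case: (k <= i)%N; rewrite ?ltnS // leqW.
rewrite (bigD1_ord k) //= eqxx.
transitivity (\sum_(i < n.+1) a i * w i j); last first.
  have [lt_jn|] := ltnP j n; first exact: aw.
  rewrite leq_eqVlt ltnNge -ltnS lt_j orbF => /eqP <-.
  by rewrite big1 // => m _; rewrite /w divfK // subrr mulr0.
rewrite mulNr addrC mulr_suml -sumrB; apply: eq_bigr => m _.
by rewrite [bump _ _ == _]eq_sym (negbTE (neq_bump _ _)) bumpK mulrBr !mulrA.
Qed.

(** * Frobenius in characteristic two and the field F_2(eps) *)

Section CharacteristicTwo.
Variables (R : comNzRingType) (charR : 2 \in [pchar R]).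

Lemma exprD_pow2 (x y : R) k : (x + y) ^+ (2 ^ k) = x ^+ (2 ^ k) + y ^+ (2 ^ k).
Proof. by rewrite exprDn_pchar // pnatX (pnatE _ (isT : prime 2)) charR. Qed.

Lemma exprB_pow2 (x y : R) k : (x - y) ^+ (2 ^ k) = x ^+ (2 ^ k) - y ^+ (2 ^ k).
Proof. by rewrite !GRing.subr_pchar2 // exprD_pow2. Qed.

Lemma sqr_sum (I : Type) (r : seq I) (P : pred I) (F : I -> R) :
  (\sum_(i <- r | P i) F i) ^+ 2 = \sum_(i <- r | P i) F i ^+ 2.
Proof.
apply: (big_morph (fun x => x ^+ 2)) => [x y|]; last by rewrite expr0n.
exact: (exprD_pow2 x y 1).
Qed.

End CharacteristicTwo.

Lemma pchar_poly_F2 : 2 \in [pchar {poly F2}].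
Proof. by rewrite pchar_poly pchar_Fp. Qed.

Lemma pchar_F2t : 2 \in [pchar F2t].
Proof. exact: (rmorph_pchar (@FracField.tofrac {poly F2})) pchar_poly_F2. Qed.

Lemma pchar_laurent : 2 \in [pchar laurent].
Proof. exact: (rmorph_pchar poly_laurent) pchar_poly_F2. Qed.

Definition Feps (eps : nat -> {poly F2}) (m : nat) : {pred F2t} :=
  fun x => `[< in_Feps eps m x >].

Lemma Feps_divring_closed eps m : divring_closed (Feps eps m).
Proof.
split; first by apply/asboolP/Fe_one.
- by move=> x y /asboolP xK /asboolP yK; apply/asboolP/Fe_add => //; apply: Fe_opp.
by move=> x y /asboolP xK /asboolP yK; apply/asboolP/Fe_mul => //; apply: Fe_inv.
Qed.

HB.instance Definition _ eps m :=
  GRing.isDivringClosed.Build F2t (Feps eps m) (Feps_divring_closed eps m).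

(** * The convergents of s(eps) *)

Section Continuants.
Variable eps : nat -> {poly F2}.
Hypothesis eps_gt1 : forall n, (1 < size (eps n))%N.

(* The entries of the symmetric continuant matrix (p q; q r) of W_n. *)
Fixpoint contp n : {poly F2} := if n is n'.+1 then eps n' * contp n' ^+ 2 else 1.
Fixpoint contq n : {poly F2} :=
  if n is n'.+1 then eps n' * contp n' * contq n' + 1 else 0.
Fixpoint contr n : {poly F2} := if n is n'.+1 then eps n' * contq n' ^+ 2 else 1.

Lemma eps_neq0 n : eps n != 0.
Proof. by rewrite -size_poly_gt0 ltnW. Qed.

Lemma contp_neq0 n : contp n != 0.
Proof. by elim: n => [|n IHn] /=; rewrite ?oner_eq0 // mulf_neq0 ?eps_neq0 ?expf_neq0. Qed.

(** Otherwise [eps n] would divide 1 and be constant. *)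
Lemma contq_neq0 n : (0 < n)%N -> contq n != 0.
Proof.
case: n => // n _ /=; apply/negP; rewrite addr_eq0 -mulrA => /eqP epq.
have : eps n %| 1 by rewrite -[1]opprK dvdpNr -epq dvdp_mulr.
by rewrite dvdp1 eqn_leq leqNgt eps_gt1.
Qed.

Lemma addpp (p : {poly F2}) : p + p = 0.
Proof. exact: GRing.addrr_pchar2 pchar_poly_F2 _. Qed.

(** The continuant matrix has determinant 1. As p_(n+1) r_(n+1) = (eps_n p_n q_n)^2 and q_(n+1) =
    eps_n p_n q_n + 1, the two sides differ by doubled terms. *)
Lemma cont_det n : contp n * contr n = contq n ^+ 2 + 1.
Proof.
elim: n => [|n IHn] /=; first by rewrite mulr1 expr0n add0r.
transitivity ((eps n * contp n * contq n) ^+ 2); first by ring.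
rewrite sqrrD1 mulr2n addpp addr0 -addrA addpp addr0 //.
Qed.

(** Action of the product of the matrices (a 1; 1 0), a in w, on a column vector. *)
Definition cfact (w : seq {poly F2}) (xy : {poly F2} * {poly F2}) :=
  foldr (fun a xy => (a * xy.1 + xy.2, xy.1)) xy w.

Lemma cfact_cat w1 w2 xy : cfact (w1 ++ w2) xy = cfact w1 (cfact w2 xy).
Proof. exact: foldr_cat. Qed.

Lemma cfact_Wword n x y :
  cfact (Wword eps n) (x, y) = (contp n * x + contq n * y, contq n * x + contr n * y).
Proof.
elim: n x y => [|n IHn] x y /=; first by rewrite !mul1r !mul0r addr0 add0r.
rewrite cfact_cat /= IHn /= IHn /=.
have pr := cont_det n; move: (contp n) (contq n) (contr n) pr => p q r pr.
congr (_, _).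
  (* The product over W_n eps_n W_n is the wanted value plus a multiple of the determinant relation
     plus a doubled term. *)
  transitivity (eps n * p ^+ 2 * x + (eps n * p * q + 1) * y
    + (p * r - (q ^+ 2 + 1)) * y + ((p * q * x + q ^+ 2 * y) + (p * q * x + q ^+ 2 * y))).
    by ring.
  by rewrite addpp pr subrr mul0r !addr0.
transitivity ((eps n * p * q + 1) * x + eps n * q ^+ 2 * y
  + (p * r - (q ^+ 2 + 1)) * x + ((q ^+ 2 * x + q * r * y) + (q ^+ 2 * x + q * r * y))).
  by ring.
by rewrite addpp pr subrr mul0r !addr0.
Qed.

Definition cfpair w := cfact w (1, 0).

Lemma cfpair_cons a w :
  cfpair (a :: w) = (a * (cfpair w).1 + (cfpair w).2, (cfpair w).1).
Proof. by []. Qed.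

(** Non-constant quotients make degrees grow strictly, which keeps the denominators in [cfr]
    nonzero. *)
Lemma cfpair_size (w : seq {poly F2}) : (forall a, a \in w -> 1 < size a)%N ->
  (size (cfpair w).2 < size (cfpair w).1)%N.
Proof.
elim: w => [|a w IHw] w_gt1; first by rewrite size_poly0 size_poly1.
have {IHw} := IHw (fun b bw => w_gt1 b (mem_behead (s := a :: w) bw)).
have := w_gt1 a (mem_head _ _); rewrite cfpair_cons.
case: (cfpair _) => p q /= a_gt1 lt_qp.
have p_gt0 : (0 < size p)%N by apply: leq_ltn_trans lt_qp.
have lt_p : (size p < size (a * p)%R)%N.
  rewrite size_mul -?size_poly_gt0 ?(ltnW a_gt1) //.
  by case: (size a) a_gt1 => [|[|k]] // _; rewrite addSn addSn /= ltnS leq_addl.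
by rewrite size_polyDl // (ltn_trans lt_qp).
Qed.

Lemma cfr_cfpair (a : {poly F2}) w : (forall b, b \in a :: w -> 1 < size b)%N ->
  cfr (a :: w) = (cfpair (a :: w)).1%:F / (cfpair (a :: w)).2%:F.
Proof.
elim: w a => [|b w IHw] a aw_gt1; first by rewrite /= mulr1 addr0 tofrac1 divr1.
have bw_gt1 c cw := aw_gt1 c (mem_behead (s := a :: b :: w) cw).
have -> : cfr (a :: b :: w) = a%:F + (cfr (b :: w))^-1 by [].
rewrite (IHw b bw_gt1) invf_div [cfpair (a :: _)]cfpair_cons.
have := cfpair_size bw_gt1; case: (cfpair _) => p q /= lt_qp.
have p_neq0 : p != 0 by rewrite -size_poly_gt0; apply: leq_ltn_trans lt_qp.
by rewrite rmorphD rmorphM mulrDl mulfK ?tofrac_eq0.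
Qed.

Lemma size_Wword n : size (Wword eps n) = (2 ^ n).-1.
Proof.
elim: n => //= n IHn; rewrite size_cat /= IHn expnS mul2n -addnn.
by have := expn_gt0 2 n; case: (2 ^ n)%N.
Qed.

Lemma mem_Wword n a : a \in Wword eps n -> exists i, a = eps i.
Proof.
elim: n => //= n IHn; rewrite mem_cat inE => /or3P[/IHn //|/eqP->|/IHn //].
by exists n.
Qed.

Lemma nth_Wword m n i : (m <= n)%N -> (i < (2 ^ m).-1)%N ->
  nth 0 (Wword eps n) i = nth 0 (Wword eps m) i.
Proof.
move=> + lt_im; elim: n => [|n IHn]; first by rewrite leqn0 => /eqP->.
rewrite leq_eqVlt => /predU1P[-> //|]; rewrite ltnS => le_mn.
rewrite /= nth_cat size_Wword IHn // (leq_trans lt_im) //.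
by rewrite -!subn1 leq_sub2r // leq_exp2l.
Qed.

Lemma mkseq_sseq n : mkseq (sseq eps) (2 ^ n).-1 = Wword eps n.
Proof.
apply: (@eq_from_nth _ 0); first by rewrite size_mkseq size_Wword.
move=> i; rewrite size_mkseq => lt_in; rewrite nth_mkseq // /sseq.
(* [sseq] reads its letter in W_(i+1), which may be shorter or longer than W_n; index i lies in
   both. *)
have lt_i : (i < (2 ^ i.+1).-1)%N.
  by rewrite ltn_predRL; apply: leq_ltn_trans (ltn_expl i.+1 (isT : 1 < 2)%N).
by case: (leqP i.+1 n) => [|/ltnW] le_in; [symmetry|]; apply: nth_Wword.
Qed.

(* The inverse of the convergent [W_n], so that conv tends to beta. *)
Definition conv n : F2t := (contq n)%:F / (contp n)%:F.

Lemma pow2_pred_gt0 n : (0 < n)%N -> (0 < (2 ^ n).-1)%N.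
Proof.
case: n => // n _; have := ltn_expl n.+1 (isT : (1 < 2)%N).
by case: (2 ^ _)%N => [|[|k]].
Qed.

(** [convergent s k] uses k+1 quotients, so the word W_n of length 2^n - 1 gives the index 2^n -
    2. *)
Lemma convergentE n : (0 < n)%N -> convergent (sseq eps) ((2 ^ n).-1).-1 = (conv n)^-1.
Proof.
move=> n_gt0; rewrite /convergent prednK ?pow2_pred_gt0 // mkseq_sseq /conv invf_div.
have W_gt1 a : a \in Wword eps n -> (1 < size a)%N by move=> /mem_Wword[i ->].
have := cfact_Wword n 1 0; rewrite -/(cfpair _) !mulr1 !mulr0 !addr0.
have : size (Wword eps n) != 0%N by rewrite size_Wword -lt0n pow2_pred_gt0.
by case: (Wword eps n) W_gt1 => [//|a w] aw_gt1 _ wE; rewrite cfr_cfpair // wE.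
Qed.

Lemma convS n : conv n.+1 = conv n + (contp n.+1)%:F^-1.
Proof.
rewrite /conv [contq _]/= rmorphD rmorph1 mulrDl mul1r; congr (_ + _).
have p0 := contp_neq0 n; have e0 := eps_neq0 n.
apply/eqP; rewrite eqr_div ?tofrac_eq0 ?mulf_neq0 ?expf_neq0 // -!rmorphM /= tofrac_eq.
by apply/eqP; ring.
Qed.

Lemma ord_ge_conv n : ord_ge 0 (frac_laurent (conv n)).
Proof.
elim: n => [|n IHn]; first by rewrite /conv /= tofrac0 mul0r rmorph0; apply: ord_ge0.
rewrite convS rmorphD fmorphV /= frac_laurent_poly; apply: ord_geD => //.
exact: ord_ge_polyV (contp_neq0 n.+1).
Qed.

(** Since alpha beta = 1, beta - c = beta c (1/c - alpha) with c = [conv n], where c has order at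
    least 0. *)
Lemma conv_cvg alpha beta (N : nat) :
    is_CF (sseq eps) alpha -> lseq (lsmul alpha beta) lsone ->
  exists n0, forall n, (n0 <= n)%N ->
    ord_ge N%:Z (laurent_of beta - frac_laurent (conv n)).
Proof.
move=> cf_alpha /lseqP; rewrite laurent_ofM laurent_of1 => ab1.
(* The extra precision [lsh beta] absorbs the possible pole of beta. *)
have [n1 n1P] := cf_alpha (N + lsh beta)%N; exists n1.+1 => n lt_n1n.
have n_gt0 : (0 < n)%N by apply: leq_ltn_trans lt_n1n.
have := n1P ((2 ^ n).-1).-1; rewrite convergentE // => le_n1.
have {}le_n1 : (n1 <= (2 ^ n).-1.-1)%N.
  have := ltn_expl n (isT : 1 < 2)%N; move: (2 ^ n)%N => k lt_nk; lia.
have {n1P} := ord_ge_lcoef (n1P _ le_n1).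
rewrite convergentE // laurent_of_embed fmorphV /= => aN.
have y0 : frac_laurent (conv n) != 0.
  by rewrite fmorph_eq0 mulf_neq0 ?invr_eq0 ?tofrac_eq0 ?contp_neq0 ?contq_neq0.
have := ord_geM (ord_geM (ord_ge_laurent_of beta) (ord_ge_conv n)) (ord_geN aN).
rewrite addr0 PoszD [- _ + _]addrC addrK; congr (ord_ge _ _).
move: (laurent_of alpha) (laurent_of beta) (frac_laurent _) ab1 y0 => a b y ab1 y0.
by rewrite opprB mulrBr mulfK // mulrAC [b * a]mulrC ab1 mul1r.
Qed.

End Continuants.

(** * The relation between the powers of beta *)

Section Periodic.
Variables (l d : nat) (eps : nat -> {poly F2}).
Hypothesis d_gt0 : (0 < d)%N.
Hypothesis eps_gt1 : forall n, (1 < size (eps n))%N.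
Hypothesis eps_per : forall n, (l <= n)%N -> eps (n + d)%N = eps n.
Local Notation K := (Feps eps (l + d)).

Lemma eps_Feps n : (eps n)%:F \in K.
Proof.
elim/ltn_ind: n => n IHn; have [lt_n|le_n] := ltnP n (l + d).
  by apply/asboolP/Fe_gen.
have le_dn : (d <= n)%N := leq_trans (leq_addl l d) le_n.
have le_ln : (l <= n - d)%N by rewrite leq_subRL // addnC.
rewrite -(subnK le_dn) eps_per //.
by apply: IHn; rewrite ltn_subrL d_gt0 (leq_trans d_gt0).
Qed.

Lemma contp_Feps n : (contp eps n)%:F \in K.
Proof.
elim: n => [|n IHn] /=; first by rewrite tofrac1 rpred1.
by rewrite rmorphM rmorphXn rpredM ?rpredX ?eps_Feps.
Qed.

Lemma conv_Feps n : conv eps n \in K.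
Proof.
elim: n => [|n IHn]; first by rewrite /conv tofrac0 mul0r rpred0.
by rewrite convS // rpredD // rpredV contp_Feps.
Qed.

(* pratio k m is c_k(m) = p_m / p_(m-k)^(2^k) for k <= m; the values for m < k are junk. *)
Fixpoint pratio k m : F2t :=
  if k is k'.+1 then (eps m.-1)%:F * pratio k' m.-1 ^+ 2 else 1.

Lemma pratio_Feps k m : pratio k m \in K.
Proof.
elim: k m => [|k IHk] m /=; first exact: rpred1.
by apply: rpredM; [apply: eps_Feps | apply/rpredX/IHk].
Qed.

(** Induction by squaring, from p_(m+1) = eps_m p_m^2. *)
Lemma pratioE k m : (k <= m)%N ->
  (contp eps (m - k))%:F^-1 ^+ (2 ^ k) = pratio k m / (contp eps m)%:F.
Proof.
elim: k m => [|k IHk] m; first by rewrite subn0 mul1r.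
case: m => // m; rewrite ltnS => /IHk IHm; rewrite subSS expnSr exprM IHm /=.
have p0 : (contp eps m)%:F != 0 by rewrite tofrac_eq0 contp_neq0.
have e0 : (eps m)%:F != 0 by rewrite tofrac_eq0 eps_neq0.
by rewrite rmorphM rmorphXn /= expr_div_n -[RHS]mulf_div divff // mul1r.
Qed.

(** c_k(m) involves only eps_(m-k), ..., eps_(m-1), all in the periodic range once m - k >= l. *)
Lemma pratio_per k m : (l + k <= m)%N -> pratio k (m + d) = pratio k m.
Proof.
elim: k m => // k IHk m; rewrite addnS; case: m => // m; rewrite ltnS => le_m.
by rewrite /= IHk // eps_per // (leq_trans _ le_m) ?leq_addr.
Qed.

Lemma pratio_perM k m q : (l + k <= m)%N -> pratio k (m + q * d) = pratio k m.
Proof.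
move=> le_m; elim: q => [|q IHq]; first by rewrite addn0.
by rewrite mulSn [(d + _)%N]addnC addnA pratio_per // (leq_trans le_m) ?leq_addr.
Qed.

Lemma pratio_mod k j : (k <= d)%N -> pratio k (l + d + j) = pratio k (l + d + j %% d).
Proof.
move=> le_kd; rewrite {1}(divn_eq j d) [(_ + j %% d)%N]addnC addnA pratio_perM //.
by rewrite -addnA leq_add2l (leq_trans le_kd) ?leq_addr.
Qed.

(** A relation over F_2(eps) between c_0, ..., c_J, monic in c_J and valid for all large m. *)
Definition pratio_relation J := exists B : nat -> F2t,
  [/\ forall k, B k \in K, B J = 1 &
    exists M, forall m, (M <= m)%N -> \sum_(k < J.+1) B k * pratio k m = 0].

(** From rank l + d on, each c_k with k <= d is determined by its d values on one period, so
    [linear_relation] applies. J is the largest index with a nonzero coefficient, by which the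
    relation is divided. *)
Lemma pratio_relation_ex : exists2 J, (J <= d)%N & pratio_relation J.
Proof.
have [|a [aK exa av]] := @linear_relation _ (Feps eps (l + d)) d (fun i j => pratio i (l + d + j)).
  by move=> i j; apply: pratio_Feps.
have exa' : exists i, (i <= d)%N && (a i != 0) by case: exa => i le_i ai; exists i; rewrite le_i.
have maxa i : (i <= d)%N && (a i != 0) -> (i <= d)%N by case/andP.
case: (ex_maxnP exa' maxa) => J /andP[le_Jd aJ] J_max.
exists J => //; exists (fun k => a k / a J); split=> [k||].
- by rewrite rpredM ?rpredV.
- by rewrite divff.
exists (l + d)%N => m le_m; rewrite -(subnKC le_m); move: (m - (l + d))%N => j.
have := av (j %% d)%N (ltn_pmod _ d_gt0).
rewrite (eq_bigr (fun i : 'I_d.+1 => a i * pratio i (l + d + j))); last first.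
  by move=> i _; rewrite -pratio_mod // -ltnS.
move=> sum0; under eq_bigr => i _ do rewrite mulrAC.
rewrite -mulr_suml (big_ord_widen d.+1 (fun i => a i * pratio i (l + d + j))) //.
rewrite big_mkcond /= (eq_bigr (fun i : 'I_d.+1 => a i * pratio i (l + d + j))) ?sum0 ?mul0r //.
move=> i _; case: ltnP => // lt_Ji.
have [->|ai] := eqVneq (a i) 0; first by rewrite mul0r.
by have := J_max i; rewrite -ltnS ltn_ord ai leqNgt lt_Ji => /(_ isT).
Qed.

Lemma pratio_relationS J : pratio_relation J -> pratio_relation J.+1.
Proof.
move=> [B [BK BJ [M BM]]].
(* The relation at m is squared and multiplied by eps_m; every index moves up by one, leaving
   coefficient 0 at index 0. *)
exists (fun k => if k is k'.+1 then B k' ^+ 2 else 0); split=> [[|k]||].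
- by rewrite rpred0.
- by rewrite rpredX.
- by rewrite BJ expr1n.
exists M.+1 => -[//|m] le_Mm; rewrite big_ord_recl mul0r add0r /=.
rewrite (eq_bigr (fun i : 'I_J.+1 => (eps m)%:F * (B i * pratio i m) ^+ 2)).
  by rewrite -mulr_sumr -(sqr_sum pchar_F2t) BM // expr0n mulr0.
by move=> i _; rewrite exprMn mulrCA.
Qed.

Lemma pratio_relation_d : pratio_relation d.
Proof.
have [J le_Jd BJ] := pratio_relation_ex; rewrite -(subnK le_Jd).
by elim: (d - J)%N => // n IHn; apply: pratio_relationS.
Qed.

(** With the shift n - k, passing from n to n+1 adds B_k c_k(n+1) / p_(n+1) to the k-th term, and
    these increments sum to zero. *)
Lemma conv_relation : exists (A : F2t) (B : nat -> F2t),
  [/\ A \in K, forall k, B k \in K, B d = 1 & exists M, forall n, (M <= n)%N ->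
    \sum_(k < d.+1) B k * conv eps (n - k) ^+ (2 ^ k) = A].
Proof.
have [B [BK Bd [M BM]]] := pratio_relation_d.
pose z n := \sum_(k < d.+1) B k * conv eps (n - k) ^+ (2 ^ k).
exists (z (M + d)%N), B; split=> //.
  by rewrite rpred_sum // => k _; rewrite rpredM ?rpredX ?conv_Feps.
(* From M + d on, n - k is a true subtraction and the relation between the c_k holds. *)
exists (M + d)%N => n le_n; rewrite -[LHS]/(z n) -(subnK le_n).
elim: (n - _)%N => // i IHi; rewrite -IHi addSn; set m := (i + _)%N.
apply/eqP; rewrite -subr_eq0 -sumrB.
rewrite (eq_bigr (fun k : 'I_d.+1 => B k * pratio k m.+1 / (contp eps m.+1)%:F)).
  by rewrite -mulr_suml BM ?mul0r // /m; lia.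
move=> k _; have le_km : (k <= m)%N by have := ltn_ord k; rewrite /m; lia.
rewrite -mulrBr subSn // convS // (exprD_pow2 pchar_F2t) addrC addKr.
by rewrite -subSn // pratioE ?mulrA // leqW.
Qed.

End Periodic.

(** * Passage to the limit and the polynomial for alpha *)

Lemma ord_ge_eventually_sum (N : int) m (F : nat -> nat -> laurent) :
    (forall i, (i < m)%N -> exists n0, forall n, (n0 <= n)%N -> ord_ge N (F i n)) ->
  exists n0, forall n, (n0 <= n)%N -> ord_ge N (\sum_(i < m) F i n).
Proof.
elim: m => [|m IHm] Fm; first by exists 0%N => n _; rewrite big_ord0; apply: ord_ge0.
have [n1 n1P] := IHm (fun i lt_im => Fm i (leqW lt_im)).
have [n2 n2P] := Fm m (ltnSn m).
exists (maxn n1 n2) => n; rewrite geq_max => /andP[le1 le2].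
by rewrite big_ord_recr; apply: ord_geD; [apply: n1P | apply: n2P].
Qed.

Lemma laurent_relation (l d : nat) (eps : nat -> {poly F2}) :
  (1 <= d)%N ->
  (forall n, (1 < size (eps n))%N) ->
  (forall n, (l <= n)%N -> eps (n + d)%N = eps n) ->
  forall alpha beta : LS,
    is_CF (sseq eps) alpha ->
    lseq (lsmul alpha beta) lsone ->
  exists (A : F2t) (B : nat -> F2t),
  [/\ A \in Feps eps (l + d), forall k, B k \in Feps eps (l + d) &
    laurent_of beta ^+ (2 ^ d) =
      frac_laurent A + \sum_(k < d) frac_laurent (B k) * laurent_of beta ^+ (2 ^ k)].
Proof.
move=> d_gt0 eps_gt1 eps_per alpha beta cf_alpha ab1.
have [A [B [AK BK Bd [M BM]]]] := conv_relation d_gt0 eps_gt1 eps_per.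
set b := laurent_of beta.
have limA : \sum_(k < d.+1) frac_laurent (B k) * b ^+ (2 ^ k) - frac_laurent A = 0.
  apply: ord_ge_all0 => N.
  (* By Frobenius, the defect of the relation at beta is the sum of these errors. *)
  pose F k n := frac_laurent (B k) * (b - frac_laurent (conv eps (n - k))) ^+ (2 ^ k).
  have [k _|n0 n0P] := @ord_ge_eventually_sum N%:Z d.+1 F.
    have [P BP] := ord_ge_frac (B k).
    (* Precision N + P compensates a pole of order at most P of B_k. *)
    have [n1 n1P] := conv_cvg eps_gt1 (N + P)%N cf_alpha ab1.
    exists (n1 + k)%N => n le_n.
    have le_nk : (n1 <= n - k)%N by rewrite leq_subRL ?(leq_trans _ le_n) ?leq_addl // addnC.
    have := ord_geM BP (ord_geX (expn_gt0 2 k) (n1P _ le_nk)).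
    by rewrite PoszD addrC addrK.
  have := n0P (maxn n0 M) (leq_maxl _ _); congr (ord_ge _ _).
  rewrite -(BM (maxn n0 M) (leq_maxr _ _)) rmorph_sum -sumrB; apply: eq_bigr => k _.
  by rewrite /F (exprB_pow2 pchar_laurent) mulrBr -rmorphXn -rmorphM.
exists A, (fun k => - B k); split=> // [k|]; first by rewrite rpredN.
move/eqP: limA; rewrite big_ord_recr /= Bd rmorph1 mul1r subr_eq0 => /eqP <-.
rewrite addrAC -big_split big1 ?add0r // => k _.
by rewrite /= rmorphN mulNr subrr.
Qed.

(* Multiplying the relation by alpha^(2^d) gives a polynomial P0 with constant
   term -1; its degree drops when A = 0, hence the extra power of X. *)
Lemma relation_polynomial (l d : nat) (eps : nat -> {poly F2}) (A : F2t) (B : nat -> F2t)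
    (alpha beta : laurent) :
    A \in Feps eps (l + d) -> (forall k, B k \in Feps eps (l + d)) ->
    alpha * beta = 1 ->
    beta ^+ (2 ^ d) = frac_laurent A + \sum_(k < d) frac_laurent (B k) * beta ^+ (2 ^ k) ->
  exists P : {poly F2t}, [/\ P \is a polyOver (Feps eps (l + d)), size P = (2 ^ d).+1 &
    (map_poly frac_laurent P).[alpha] = 0].
Proof.
move=> AK BK ab1 bE.
pose P0 : {poly F2t} := A *: 'X^(2 ^ d) + \sum_(k < d) B k *: 'X^(2 ^ d - 2 ^ k) - 1.
have lt_pow k : (k < d)%N -> (2 ^ k < 2 ^ d)%N by move=> lt_kd; rewrite ltn_exp2l.
(* The exponents 2^d and 2^d - 2^k with k < d are positive, so only -1 contributes; hence P0 is
   nonzero. *)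
have P0_0 : P0`_0 = -1.
  rewrite coefB coefD coefZ coefXn coef_sum coef1 eq_sym expn_eq0 mulr0 add0r.
  rewrite big1 ?add0r // => k _.
  by rewrite coefZ coefXn eq_sym subn_eq0 leqNgt lt_pow ?mulr0.
have P0_neq0 : P0 != 0 by apply: contra_eq_neq P0_0 => ->; rewrite coef0 eq_sym oppr_eq0 oner_eq0.
have sP0 : (size P0 <= (2 ^ d).+1)%N.
  rewrite (leq_trans (size_polyD _ _)) // geq_max size_polyN size_poly1 andbT.
  rewrite (leq_trans (size_polyD _ _)) // geq_max.
  rewrite (leq_trans (size_scale_leq _ _)) ?size_polyXn //=.
  apply: (leq_trans (size_sum _ _ _)); apply/bigmax_leqP => k _.
  by rewrite (leq_trans (size_scale_leq _ _)) // size_polyXn ltnS leq_subr.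
exists (P0 * 'X^((2 ^ d).+1 - size P0)); split.
- rewrite rpredM ?rpredX ?polyOverX // rpredB ?rpred1 // rpredD //.
    by rewrite polyOverZ ?rpredX ?polyOverX.
  by rewrite rpred_sum // => k _; rewrite polyOverZ ?rpredX ?polyOverX.
- by rewrite size_mulXn // subnK.
rewrite rmorphM hornerM /= [X in X * _](_ : _ = 0) ?mul0r //.
have apow k : (k <= d)%N -> alpha ^+ (2 ^ d - 2 ^ k) = alpha ^+ (2 ^ d) * beta ^+ (2 ^ k).
  move=> le_kd; have le2 : (2 ^ k <= 2 ^ d)%N by rewrite leq_exp2l.
  by rewrite -{2}(subnK le2) exprD -mulrA -exprMn ab1 expr1n mulr1.
rewrite rmorphB rmorphD rmorph_sum rmorph1 /= !hornerE horner_sum.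
rewrite map_polyZ map_polyXn !hornerE.
rewrite (eq_bigr (fun k : 'I_d => alpha ^+ (2 ^ d) * (frac_laurent (B k) * beta ^+ (2 ^ k)))).
  have := apow d (leqnn d); rewrite subnn expr0 bE => ->.
  by rewrite -mulr_sumr mulrDr [frac_laurent A * _]mulrC subrr.
move=> k _; rewrite map_polyZ map_polyXn hornerZ hornerXn apow; last exact: ltnW.
exact: mulrCA.
Qed.

Unset Implicit Arguments.
Theorem mainTheorem1 (l d : nat) (eps : nat -> {poly 'F_2}) :
  (1 <= d)%N ->
  (forall n, (1 < size (eps n))%N) ->
  (forall n, (l <= n)%N -> eps (n + d)%N = eps n) ->
  forall alpha beta : LS,
    is_CF (sseq eps) alpha ->
    lseq (lsmul alpha beta) lsone ->
    (exists P : {poly {fraction {poly 'F_2}}},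
        (forall i, in_Feps eps (l + d) P`_i) /\
        size P = (2 ^ d).+1 /\
        lseq (lspeval P alpha) lszero) /\
    (exists (A : {fraction {poly 'F_2}}) (B : nat -> {fraction {poly 'F_2}}),
        in_Feps eps (l + d) A /\
        (forall k, (k < d)%N -> in_Feps eps (l + d) (B k)) /\
        lseq (lsexp beta (2 ^ d))
             (lsadd (lsembed A)
                (\big[lsadd/lszero]_(k < d) lsmul (lsembed (B k)) (lsexp beta (2 ^ k))))).
Proof.
move=> d_gt0 eps_gt1 eps_per alpha beta cf_alpha ab1.
have [A [B [AK BK bE]]] := laurent_relation d_gt0 eps_gt1 eps_per cf_alpha ab1.
split.
  have abL : laurent_of alpha * laurent_of beta = 1.
    by rewrite -laurent_ofM -laurent_of1; apply/lseqP.
  have [P [/polyOverP PK sP Pa]] := relation_polynomial AK BK abL bE.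
  exists P; split; first by move=> i; apply/asboolP/PK.
  (* Through [laurent_of], [lspeval] becomes Horner evaluation of the embedded polynomial. *)
  split=> //; apply/lseqP; rewrite laurent_of0 -Pa laurent_of_sum.
  rewrite (horner_coef_wide _ (size_poly _ _)); apply: eq_bigr => i _.
  by rewrite laurent_ofM laurent_ofX laurent_of_embed coef_map.
exists A, B; split; first exact/asboolP.
split=> [k _|]; first exact/asboolP/BK.
apply/lseqP; rewrite laurent_ofX bE laurent_ofD laurent_of_embed laurent_of_sum.
congr (_ + _); apply: eq_bigr => k _.
by rewrite laurent_ofM laurent_ofX laurent_of_embed.
Qed.
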